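(* Let $k\ge 2$, let $H$ be a fixed $k$-uniform hypergraph and let $c\in[0,1]$. Then $$\mathcal{M}_H(c) = \limsup_{G\in\mathcal{C}_c} t(H,G) = \limsup_{G\in\mathcal{C}_c\cap\mathcal{T}} t(H,G),$$ where $\mathcal{C}_c$ is the set of $k$-uniform hypergraphs of edge density at most $c$ and $\mathcal{T}$ is the set of $k$-uniform threshold hypergraphs.
   Context: Hypergraphs are finite; a $k$-uniform hypergraph $G=(V,E)$ has $E\subseteq\binom{V}{k}$, and $|G|=|V|$. A homomorphism from $H$ to $G$ is a map $\varphi:V(H)\to V(G)$ with $\varphi(e)\in E(G)$ for every $e\in E(H)$; $\hom(H,G)$ is the number of homomorphisms and $t(H,G)=\hom(H,G)/|G|^{|H|}$. The edge density of a $k$-uniform hypergraph $G$ is $t(K,G)$, where $K$ is the $k$-uniform hypergraph consisting of $k$ vertices and a single edge (so it equals $k!\,|E(G)|/|G|^k$). For a class $\mathcal{C}$, $\limsup_{G\in\mathcal{C}} f(G)=\lim_{n\to\infty}\sup\{f(G):G\in\mathcal{C},|G|\ge n\}$. By definition $\mathcal{M}_H(c)=\limsup_{G\in\mathcal{C}_c}t(H,G)$. For vertices $x,y$ of $G$, write $x\ll_G y$ if for every $e\in E(G)$ with $x\in e$ and $y\notin e$ we have $(e\setminus\{x\})\cup\{y\}\in E(G)$. $G$ is a threshold hypergraph if for any two vertices $x,y$ either $x\ll_G y$ or $y\ll_G x$. *)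

(* Defs.v *)
From mathcomp Require Import all_boot all_order all_algebra.
From mathcomp Require Import all_classical all_reals all_analysis.
Set Implicit Arguments.
Unset Strict Implicit.
Unset Printing Implicit Defensive.
Import Order.TTheory GRing.Theory Num.Theory.
Local Open Scope classical_set_scope.
Local Open Scope ring_scope.

Record hypergraph (k : nat) := Hypergraph {
  vert : finType;
  edges : {set {set vert}};
  edges_uniform : forall e : {set vert}, e \in edges -> #|e| = k }.

Definition nverts (k : nat) (G : hypergraph k) : nat := #|vert G|.

Definition is_hom (k : nat) (H G : hypergraph k)
    (phi : {ffun vert H -> vert G}) : bool :=
  [forall e in edges H, [set phi x | x in e]%SET \in edges G].

Definition hom_count (k : nat) (H G : hypergraph k) : nat :=
  #|[set phi : {ffun vert H -> vert G} | is_hom phi]%SET|.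

Definition hom_density (R : realType) (k : nat) (H G : hypergraph k) : R :=
  (hom_count H G)%:R / (nverts G)%:R ^+ nverts H.

Lemma single_edge_uniform (k : nat) (e : {set 'I_k}) :
  e \in [set [set: 'I_k]]%SET -> #|e| = k.
Proof. by rewrite finset.inE => /eqP ->; rewrite cardsT card_ord. Qed.

Definition single_edge (k : nat) : hypergraph k :=
  Hypergraph (@single_edge_uniform k).

Definition edge_density (R : realType) (k : nat) (G : hypergraph k) : R :=
  hom_density R (single_edge k) G.

Definition vertex_le (k : nat) (G : hypergraph k) (x y : vert G) : Prop :=
  forall e : {set vert G}, e \in edges G -> x \in e -> y \notin e ->
    (e :\ x :|: [set y])%SET \in edges G.

Definition is_threshold (k : nat) (G : hypergraph k) : Prop :=
  forall x y : vert G, vertex_le x y \/ vertex_le y x.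

(* Classes are plain predicates because hypergraph k lives in too large a
   universe for classical_sets.set. *)
Definition density_le (R : realType) (k : nat) (c : R) : hypergraph k -> Prop :=
  fun G => edge_density R G <= c.

Definition class_inter (k : nat) (C D : hypergraph k -> Prop) :
    hypergraph k -> Prop :=
  fun G => C G /\ D G.

(* The suprema are taken in \bar R, where they exist for every class (the
   supremum of the empty set being -oo) and are nonincreasing in n, so that the
   limit always exists. *)
Definition limsup_class (R : realType) (k : nat) (C : hypergraph k -> Prop)
    (f : hypergraph k -> R) : \bar R :=
  limn (fun n : nat =>
    ereal_sup [set y : \bar R | exists G : hypergraph k,
      [/\ C G, (n <= nverts G)%N & y = (f G)%:E]]).

Definition max_density (R : realType) (k : nat) (H : hypergraph k) (c : R) :
    \bar R :=
  limsup_class (@density_le R k c) (@hom_density R k H).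

(* Main.v *)
(** Order the [n] vertices of [G] and compress along pairs [x < y], replacing [x]
    by [y] in the edges where this creates a new edge.  A compression that moves
    [d] edges keeps the number of edges and costs only [O(d n^(h - k - 1))]
    homomorphisms, where [h = |H|], as the lost ones use a moved edge and also
    hit [y]; it increases the sum of the ranks over all edges by [d (y - x)].  So
    a maximizer [E] of [hom + (1 / Q) n^(h - k - 1) weight] over the families
    with as many edges as [G] has [x << y] exactly as soon as [y - x] exceeds
    a constant [M = M(Q, H)], while [t(H, E) >= t(H, G) - k / Q].  The images of
    edges of [E] under injections raising every rank by at least [M] form a
    subfamily of [E] that is an up-set, hence threshold, and misses only
    [O(M n^(k - 1))] edges of [E]. *)
From mathcomp Require Import all_boot perm zify.
Set Implicit Arguments.
Unset Strict Implicit.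
Unset Printing Implicit Defensive.

(** * Counting homomorphisms and edges *)

Definition homs (W V : finType) (F : {set {set W}}) (E : {set {set V}}) :
    {set {ffun W -> V}} :=
  [set phi : {ffun W -> V} | [forall e in F, phi @: e \in E]].

(** With [e'] empty and [d] an edge, this bounds the maps sending a given edge into [d]. Taking
    singletons for [e'] and [d'] saves one more factor [#|V|], which is what makes compressions
    cheap. *)
Lemma card_maps_sub (W V : finType) (e e' : {set W}) (d d' : {set V}) :
    [disjoint e & e'] ->
  #|[set phi : {ffun W -> V} | (phi @: e \subset d) && (phi @: e' \subset d')]|
    <= #|d| ^ #|e| * #|d'| ^ #|e'| * #|V| ^ (#|W| - #|e| - #|e'|).
Proof.
move=> dis.
pose F x : {set V} := if x \in e then d else if x \in e' then d' else [set: V].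
have dis' x : x \in e' -> x \in e = false.
  by move=> xe'; apply: (disjointFl dis).
have -> : #|d| ^ #|e| * #|d'| ^ #|e'| * #|V| ^ (#|W| - #|e| - #|e'|)
    = #|family (fun x => mem (F x))|.
  rewrite card_family foldrE big_map big_enum /= (bigID (mem e)) /= -mulnA.
  congr (_ * _).
    rewrite (eq_bigr (fun=> #|d|)) ?prod_nat_const // => x xe.
    by rewrite /F xe.
  rewrite (bigID (mem e')) /=; congr (_ * _).
    rewrite (eq_bigl (mem e')) => [|x].
      rewrite (eq_bigr (fun=> #|d'|)) ?prod_nat_const // => x xe'.
      by rewrite /F dis' // ifT.
    by apply: andb_idl => /dis' ->.
  rewrite (eq_bigr (fun=> #|V|)) => [|x /andP[/negPf xe /negPf xe']]; last first.
    by rewrite /F xe xe' cardsT.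
  rewrite prod_nat_const; congr (_ ^ _).
  have <- : #|~: (e :|: e')| = #|[pred x | (x \notin e) && (x \notin e')]|.
    by apply: eq_card => x; rewrite !inE negb_or.
  rewrite -subnDA [#|W|](esym (cardsC (e :|: e'))).
  have -> : #|e :|: e'| = #|e| + #|e'|.
    by apply/eqP; have [_ ->] := leq_card_setU e e'.
  by rewrite addKn.
apply/subset_leq_card/subsetP => phi; rewrite inE => /andP[/subsetP s1 /subsetP s2].
apply/familyP => x; rewrite /F; case: ifP => xe; first by apply/s1/imset_f.
by case: ifP => xe'; [apply/s2/imset_f|rewrite inE].
Qed.

Lemma leq_bin_exp n k : 'C(n, k) <= n ^ k.
Proof.
have [le_kn|lt_nk] := leqP k n; last by rewrite bin_small.
apply: (@leq_trans (n ^_ k)).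
  by rewrite -bin_ffact leq_pmulr ?fact_gt0.
rewrite ffact_prod -[k in n ^ k]card_ord -prod_nat_const.
by apply: leq_prod => i _; apply: leq_subr.
Qed.

Lemma card_uniform_le (V : finType) (k : nat) (E : {set {set V}}) :
  (forall e, e \in E -> #|e| = k) -> #|E| <= #|V| ^ k.
Proof.
move=> uE; apply: leq_trans (leq_bin_exp _ _); rewrite -card_draws.
by apply/subset_leq_card/subsetP => e /uE /eqP; rewrite inE.
Qed.

(** Each such edge arises by adding a vertex of [B] to a [k]-set. *)
Lemma card_uniform_meet_le (V : finType) (k : nat) (E : {set {set V}})
    (B : {set V}) :
    (forall e, e \in E -> #|e| = k.+1) ->
    (forall e, e \in E -> exists2 v, v \in B & v \in e) ->
  #|E| <= #|B| * #|V| ^ k.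
Proof.
move=> uE mE.
pose P := [set s : {set V} | #|s| == k].
apply: (@leq_trans #|setX B P|); last first.
  by rewrite cardsX leq_mul // card_draws leq_bin_exp.
apply: leq_trans (leq_imset_card (fun p => p.1 |: p.2) _).
apply/subset_leq_card/subsetP => e eE; have [v vB ve] := mE e eE.
apply/imsetP; exists (v, e :\ v); last by rewrite setD1K.
by rewrite !inE /= vB -eqSS -(uE e eE) [#|e|](cardsD1 v) ve add1n eqxx.
Qed.

(** A union bound. The factor [m] will be a power of [#|V|], so that estimates of order [n^(h - k)]
    can be stated without subtracting exponents. *)
Lemma card_bigcup_le (I T : finType) (A : {set I}) (S : I -> {set T}) (m N : nat) :
    (forall i, i \in A -> #|S i| * m <= N) ->
  #|\bigcup_(i in A) S i| * m <= #|A| * N.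
Proof.
move=> Sm; rewrite -[X in _ <= X]sum_nat_const.
apply: (@leq_trans (\sum_(i in A) #|S i| * m)); last by apply: leq_sum.
elim/big_rec2: _ => [|i y1 y2 _ le]; first by rewrite cards0.
apply: leq_trans (leq_mul (leq_card_setU _ _) (leqnn _)) _.
by rewrite mulnDl leq_add2l.
Qed.

(* Deleting the edges outside [T] destroys only the homomorphisms using one. *)
Lemma homs_subset_loss (W V : finType) (k : nat) (F : {set {set W}})
    (E T : {set {set V}}) :
    (forall e, e \in F -> #|e| = k) -> (forall e, e \in E -> #|e| = k) ->
  #|homs F E| * #|V| ^ k
    <= #|homs F T| * #|V| ^ k + #|F| * k ^ k * #|E :\: T| * #|V| ^ #|W|.
Proof.
move=> uF uE.
pose B (e : {set W}) (d : {set V}) := [set phi : {ffun W -> V} | phi @: e == d].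
have cB e d : e \in F -> d \in E :\: T -> #|B e d| * #|V| ^ k <= k ^ k * #|V| ^ #|W|.
  move=> eF; rewrite inE => /andP[_ dE].
  have keW : k <= #|W| by rewrite -(uF e eF) max_card.
  rewrite -[in X in _ <= X](subnK keW) expnD mulnA leq_mul2r; apply/orP; right.
  have := @card_maps_sub W V e set0 d set0.
  rewrite disjoint_sym disjoints_subset sub0set uF // uE // !cards0 expn0 muln1.
  move=> /(_ isT); rewrite subn0; apply: leq_trans.
  apply/subset_leq_card/subsetP => phi; rewrite !inE => /eqP ->.
  by rewrite subxx imset0 sub0set.
have sub : homs F E \subset homs F T :|:
    \bigcup_(e in F) \bigcup_(d in E :\: T) B e d.
  apply/subsetP => phi; rewrite !inE => /forall_inP hphi.
  case: (boolP [forall e in F, _]) => //= /forall_inPn[e eF nT].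
  apply/bigcupP; exists e => //; apply/bigcupP; exists (phi @: e).
    by rewrite inE nT hphi.
  by rewrite inE.
apply: leq_trans (leq_mul (subset_leq_card sub) (leqnn _)) _.
apply: leq_trans (leq_mul (leq_card_setU _ _) (leqnn _)) _.
rewrite mulnDl leq_add2l.
rewrite -!mulnA; apply: card_bigcup_le => e eF.
by rewrite mulnCA; apply: card_bigcup_le => d; apply: cB.
Qed.

(** * Compressions *)

(** These edges are the obstructions to [x << y]. Swapping by [tperm], rather than deleting and
    inserting, gives an involution that visibly preserves cardinality. *)
Definition blocked (V : finType) (x y : V) (E : {set {set V}}) : {set {set V}} :=
  [set e in E | [&& x \in e, y \notin e & tperm x y @: e \notin E]].

(** The shifting operator of extremal set theory. *)
Definition compress (V : finType) (x y : V) (E : {set {set V}}) : {set {set V}} :=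
  E :\: blocked x y E :|: (fun e : {set V} => tperm x y @: e) @: blocked x y E.

Definition weight (V : finType) (r : V -> nat) (E : {set {set V}}) : nat :=
  \sum_(e in E) \sum_(v in e) r v.

Lemma mem_tperm_imset (V : finType) (x y z : V) (e : {set V}) :
  (z \in tperm x y @: e) = (tperm x y z \in e).
Proof. by rewrite -{1}(tpermK x y z) mem_imset //; apply: perm_inj. Qed.

Lemma tperm_imset_inj (V : finType) (x y : V) :
  injective (fun e : {set V} => tperm x y @: e).
Proof.
apply: inv_inj => e; apply/setP => z.
by rewrite !mem_tperm_imset tpermK.
Qed.

Lemma disjoint_compress (V : finType) (x y : V) (E : {set {set V}}) :
  [disjoint E :\: blocked x y E &
    (fun e : {set V} => tperm x y @: e) @: blocked x y E].
Proof.
rewrite disjoint_sym disjoints_subset; apply/subsetP => _ /imsetP[e eD ->].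
move: eD; rewrite !inE => /and4P[eE xe ye neE].
by rewrite (negPf neE) andbF.
Qed.

Lemma card_compress (V : finType) (x y : V) (E : {set {set V}}) :
  #|compress x y E| = #|E|.
Proof.
have [_ /esym] := leq_card_setU (E :\: blocked x y E)
  ((fun e : {set V} => tperm x y @: e) @: blocked x y E).
rewrite disjoint_compress => /esym/eqP ->.
rewrite card_imset; last exact: tperm_imset_inj.
have sD : blocked x y E \subset E by apply/subsetP => e; rewrite inE => /andP[].
by rewrite addnC -[in RHS](cardsID (blocked x y E)) (setIidPr sD).
Qed.

Lemma compress_uniform (V : finType) (k : nat) (x y : V) (E : {set {set V}}) :
    (forall e, e \in E -> #|e| = k) ->
  forall e, e \in compress x y E -> #|e| = k.
Proof.
move=> uE e; rewrite inE => /orP[|/imsetP[d + ->]]; rewrite inE.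
  by case/andP => _ /uE.
by case/andP => /uE <- _; rewrite card_imset //; apply: perm_inj.
Qed.

(** Each moved edge trades [r x] for [r y]; the products stand on opposite sides to avoid truncated
    subtraction. *)
Lemma weight_compress (V : finType) (r : V -> nat) (x y : V) (E : {set {set V}}) :
  weight r (compress x y E) + #|blocked x y E| * r x =
  weight r E + #|blocked x y E| * r y.
Proof.
set D := blocked x y E; set D' := (fun e : {set V} => tperm x y @: e) @: D.
have sD : D \subset E by apply/subsetP => e; rewrite inE => /andP[].
rewrite /weight /compress -/D -/D' (eq_bigl [in [predU E :\: D & D']]) => [|e].
  rewrite bigU ?disjoint_compress //=.
  rewrite big_imset; last by move=> ? ? _ _; apply: tperm_imset_inj.
  rewrite [in RHS](big_setID D) /= (setIidPr sD).
  rewrite -addnA -sum_nat_const -big_split /= [in RHS]addnAC -sum_nat_const.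
  rewrite -big_split /= addnC; congr (_ + _); apply: eq_bigr => e.
  rewrite inE => /and4P[_ xe ye _].
  rewrite big_imset /=; last by move=> ? ? _ _; apply: perm_inj.
  rewrite !(big_setD1 x xe) /= tpermL addnAC [in RHS]addnAC [r y + _]addnC.
  congr (_ + _); apply: eq_bigr => z; rewrite !inE => /andP[zx ze].
  by rewrite tpermD // eq_sym //; apply: contraNneq ye => <-.
by rewrite in_setU.
Qed.

(* A homomorphism using a blocked edge survives the compression once [x] and [y]
   are exchanged, unless [y] is also in its image. *)
Lemma homs_compress (W V : finType) (k : nat) (F : {set {set W}})
    (E : {set {set V}}) (x y : V) :
    (forall e, e \in F -> #|e| = k) -> (forall e, e \in E -> #|e| = k) ->
  #|homs F E| * #|V| ^ k.+1 <= #|homs F (compress x y E)| * #|V| ^ k.+1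
    + #|F| * #|W| * k ^ k * #|blocked x y E| * #|V| ^ #|W|.
Proof.
move=> uF uE; set D := blocked x y E.
pose sw (phi : {ffun W -> V}) : {ffun W -> V} := [ffun w => tperm x y (phi w)].
have sw_inj : injective sw.
  move=> f g /ffunP fg; apply/ffunP => w; have := fg w; rewrite !ffunE.
  exact: perm_inj.
have swE phi (e : {set W}) : sw phi @: e = tperm x y @: (phi @: e).
  by rewrite -imset_comp; apply: eq_imset => w; rewrite ffunE.
(* Homomorphisms into [E] split into those using no blocked edge ([A1]), those using one but
   avoiding [y] ([A2]), and the rest, which send an edge of [F] onto a blocked edge and a vertex
   outside it to [y]. *)
pose A1 := homs F (E :\: D).
pose A2 := [set phi in homs F E :\: A1 | [forall w, phi w != y]].
pose P := [set p : {set W} * W | (p.1 \in F) && (p.2 \notin p.1)].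
pose B (p : {set W} * W) (d : {set V}) :=
  [set phi : {ffun W -> V} | (phi @: p.1 \subset d) &&
    (phi @: [set p.2] \subset [set y])].
have cB p d : p \in P -> d \in D ->
    #|B p d| * #|V| ^ k.+1 <= k ^ k * #|V| ^ #|W|.
  rewrite !inE => /andP[pF np] /andP[dE _].
  have kW : k < #|W|.
    by rewrite -(uF _ pF) -cardsT; apply/proper_card/properP; split => //; exists p.2.
  rewrite -[in X in _ <= X](subnK kW) expnD mulnA leq_mul2r; apply/orP; right.
  have := @card_maps_sub W V p.1 [set p.2] d [set y].
  rewrite disjoint_sym disjoints1 uF // uE // !cards1 expn1 muln1 => /(_ np).
  by rewrite -subnDA addn1.
have sub : homs F E \subset A1 :|: A2 :|: \bigcup_(p in P) \bigcup_(d in D) B p d.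
  apply/subsetP => phi hphi; rewrite in_setU.
  case: (boolP (phi \in A1 :|: A2)) => //=.
  rewrite in_setU negb_or /A2 => /andP[nA1].
  rewrite in_set in_setD nA1 hphi /= => /forallPn[w].
  rewrite negbK => /eqP phiw.
  move: hphi nA1; rewrite !inE => /forall_inP hphi /forall_inPn[e eF].
  rewrite inE hphi // andbT negbK => eD.
  apply/bigcupP; exists (e, w).
    rewrite inE /= eF /=; apply: contraTN eD => we.
    by rewrite inE -phiw imset_f //= !andbF.
  apply/bigcupP; exists (phi @: e) => //.
  by rewrite inE /= subxx imset_set1 phiw subxx.
have subE : A1 :|: sw @: A2 \subset homs F (compress x y E).
  rewrite subUset; apply/andP; split; apply/subsetP => phi.
    rewrite !inE => /forall_inP h; apply/forall_inP => e eF.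
    by rewrite inE h.
  case/imsetP => {}phi + ->; rewrite inE in_setD => /andP[/andP[_]].
  rewrite !inE => /forall_inP h /forallP ny; apply/forall_inP => e eF.
  have ye : y \notin phi @: e.
    by apply/imsetP => -[w _ yw]; have := ny w; rewrite -yw eqxx.
  rewrite swE inE; case: (boolP (phi @: e \in D)) => eD.
    by apply/orP; right; apply: imset_f.
  have [xe|xe] := boolP (x \in phi @: e).
    (* The swapped edge lies in [E] because the original is not blocked; it misses [x], so it is not
       blocked itself and survives. *)
    rewrite in_setD !inE mem_tperm_imset tpermL (negPf ye) /= andbF /=.
    by move: eD; rewrite inE h // xe ye /= negbK => ->.
  suff -> : tperm x y @: (phi @: e) = phi @: e by rewrite in_setD eD h.
  apply/setP => z; rewrite mem_tperm_imset.
  by case: tpermP => // ->; rewrite (negPf xe) (negPf ye).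
(* If [phi] sends [e] to a blocked edge, [sw phi] sends [e] to a set outside [E]. *)
have dis : [disjoint A1 & sw @: A2].
  rewrite disjoint_sym disjoints_subset; apply/subsetP => _ /imsetP[phi + ->].
  rewrite inE in_setD => /andP[/andP[+ +] _]; rewrite !inE.
  move=> /forall_inPn[e eF neD] /forall_inP h; apply/forall_inPn; exists e => //.
  move: neD; rewrite in_setD h // andbT negbK => eD.
  by rewrite swE in_setD negb_and; move: eD; rewrite inE => /and4P[_ _ _ ->]; rewrite orbT.
apply: leq_trans (leq_mul (subset_leq_card sub) (leqnn _)) _.
apply: leq_trans (leq_mul (leq_card_setU _ _) (leqnn _)) _.
rewrite mulnDl; apply: leq_add.
  rewrite leq_mul2r; apply/orP; right.
  apply: leq_trans (leq_card_setU _ _) _.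
  rewrite -[#|A2|](card_imset _ sw_inj); have [_ /esym] := leq_card_setU A1 (sw @: A2).
  by rewrite dis => /esym/eqP <-; apply: subset_leq_card.
have cP : #|P| <= #|F| * #|W|.
  rewrite -(cardsT W) -cardsX; apply/subset_leq_card/subsetP => p.
  by rewrite !inE => /andP[->].
apply: (@leq_trans (#|P| * (#|D| * (k ^ k * #|V| ^ #|W|)))).
  by apply: card_bigcup_le => p pP; apply: card_bigcup_le => d; apply: cB.
rewrite -!mulnA [X in _ <= _ * X]mulnA; apply: (leq_trans (leq_mul cP (leqnn _))).
by rewrite leq_eqVlt; apply/orP; left; apply/eqP; lia.
Qed.

(** * Subfamilies of edges raised by [M] ranks *)

(** Equality of cardinalities encodes the injectivity of [g] on [e], and [g] is a finite function so
    that membership is boolean. *)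
Definition upshift (V : finType) (r : V -> nat) (M : nat) (E : {set {set V}}) :
    {set {set V}} :=
  [set f : {set V} | [exists e in E, exists g : {ffun V -> V},
    [&& #|f| == #|e|, f == g @: e & [forall v in e, r v + M <= r (g v)]]]].

Lemma upshiftP (V : finType) (r : V -> nat) (M : nat) (E : {set {set V}})
    (f : {set V}) :
  reflect (exists2 e, e \in E & exists2 g : V -> V, {in e &, injective g} &
      f = g @: e /\ {in e, forall v, r v + M <= r (g v)})
    (f \in upshift r M E).
Proof.
rewrite inE; apply: (iffP exists_inP) => -[e eE].
  case/existsP => g /and3P[cf /eqP fg /forall_inP gM]; exists e => //.
  by exists g => //; apply/imset_injP; rewrite -fg.
case=> g ginj [fg gM]; exists e => //; apply/existsP; exists (finfun g).
have ffE : finfun g @: e = g @: e by apply: eq_imset => v; rewrite ffunE.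
rewrite ffE fg eqxx card_in_imset // eqxx /=.
by apply/forall_inP => v ve; rewrite ffunE gM.
Qed.

(** Composing the injection with the transposition only raises ranks further: as [f] avoids [y], the
    value [x] alone changes. *)
Lemma upshift_up (V : finType) (r : V -> nat) (M : nat) (E : {set {set V}})
    (x y : V) (f : {set V}) :
    r x <= r y -> f \in upshift r M E -> x \in f -> y \notin f ->
  tperm x y @: f \in upshift r M E.
Proof.
move=> rxy /upshiftP[e eE [g ginj [fg gM]]] xf yf.
apply/upshiftP; exists e => //; exists (tperm x y \o g).
  by move=> a b ae be /= /perm_inj; apply: ginj.
split; first by rewrite imset_comp -fg.
move=> v ve /=; apply: leq_trans (gM v ve) _.
have : g v \in f by rewrite fg imset_f.
by case: tpermP => [->|->|] //; rewrite (negPf yf).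
Qed.

(* The elements of [e] are moved one at a time, starting with the largest, so
   that the target of a move is never occupied. *)
Lemma upshift_sub (V : finType) (r : V -> nat) (M : nat) (E : {set {set V}}) :
    injective r -> 0 < M ->
    (forall x y, r x + M <= r y -> blocked x y E = set0) ->
  upshift r M E \subset E.
Proof.
move=> rinj M0 nb; apply/subsetP => _ /upshiftP[e eE [g ginj [-> gM]]].
(* Stage [s] has moved the vertices of rank at least [s]: [h N] is the identity, [h 0] is [g], and
   each stage moves at most one vertex of [e]. *)
pose h s v := if s <= r v then g v else v.
pose N := (\max_v r v).+1.
suff hE j s : s + j = N -> h s @: e \in E.
  by have := hE N 0 (add0n _); congr (_ \in E); apply: eq_imset => v.
elim: j s => [s|j IH s sN].
  rewrite addn0 => ->; have -> : h N @: e = id @: e; last by rewrite imset_id.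
  apply: eq_in_imset => v _; rewrite /h leqNgt ltnS.
  by rewrite (leq_bigmax v).
have {}IH := IH s.+1 _.
have {IH}hS : h s.+1 @: e \in E by apply: IH; rewrite addSnnS.
have hne v : r v != s -> h s v = h s.+1 v.
  by move=> vs; rewrite /h leq_eqVlt eq_sym (negPf vs).
case: (pickP [pred v in e | r v == s]) => [x /= /andP[xe /eqP rx]|none]; last first.
  have -> // : h s @: e = h s.+1 @: e.
  apply: eq_in_imset => v ve; apply: hne.
  by have := none v; rewrite /= ve /= => ->.
have hx : h s.+1 x = x by rewrite /h rx ltnn.
have xgx := gM x xe.
(* Vertices already moved lie above [x] and avoid [g x] by injectivity; those not yet moved lie
   below [g x], as [M] is positive. *)
have hz z : z \in e -> z != x -> (h s.+1 z != x) && (h s.+1 z != g x).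
  move=> ze zx; have gz := gM z ze; rewrite /h; case: ltnP => rz.
    rewrite (inj_in_eq ginj) // zx andbT.
    by apply/eqP => gzx; move: gz; rewrite gzx; lia.
  by rewrite zx; apply/eqP => zg; move: rz; rewrite zg; lia.
have -> : h s @: e = tperm x (g x) @: (h s.+1 @: e).
  rewrite -imset_comp; apply: eq_in_imset => z ze /=.
  have [->|zx] := eqVneq z x; first by rewrite hx tpermL /h rx leqnn.
  have /andP[h1 h2] := hz z ze zx.
  rewrite hne; last by rewrite -rx (inj_eq rinj).
  by rewrite tpermD // eq_sym.
(* Otherwise the current edge is blocked for [x] and [g x], whose ranks differ by at least [M]. *)
apply: contraT => nE.
have : h s.+1 @: e \in blocked x (g x) E.
  rewrite inE hS nE andbT /=; apply/andP; split.
    by rewrite -[X in X \in _]hx imset_f.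
  apply/imsetP => -[z ze gxz]; have [zx|zx] := eqVneq z x.
    by move: xgx; rewrite gxz zx hx; lia.
  by have := hz z ze zx; rewrite -gxz eqxx andbF.
by rewrite nb ?inE.
Qed.

(** Raising every rank by exactly [M] injects the edges avoiding the top [M] ranks into the upshift;
    every other edge meets those top vertices. *)
Lemma card_upshift_loss (V : finType) (k M : nat) (E : {set {set V}}) :
    (forall e, e \in E -> #|e| = k.+1) ->
  #|E| <= #|upshift (fun v : V => enum_rank v : nat) M E| + M * #|V| ^ k.
Proof.
move=> uE; pose r (v : V) : nat := enum_rank v.
have rinj : injective r by move=> u v /val_inj/enum_rank_inj.
pose hi := [set v | r v + M < #|V|].
pose E1 := [set e in E | e \subset hi].
have -> : #|E| = #|E1| + #|E :\: E1|.
  rewrite -(cardsID E1 E); congr (_ + _); congr #|pred_of_set _|.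
  by apply/setIidPr/subsetP => e; rewrite inE => /andP[].
apply: leq_add.
  (* The default [enum_rank v] of [insubd] is reached only outside [hi]. *)
  pose sh (v : V) : V := enum_val (insubd (enum_rank v) (r v + M)).
  have rsh v : v \in hi -> r (sh v) = r v + M.
    by rewrite inE /r /sh enum_valK val_insubd => ->.
  have shi : {in hi &, injective sh}.
    move=> u v uh vh uv; apply: rinj; apply/eqP.
    by rewrite -(eqn_add2r M) -!rsh // uv.
  have E1hi e : e \in E1 -> {subset e <= hi}.
    by rewrite inE => /andP[_ /subsetP].
  rewrite -(card_in_imset (f := fun e : {set V} => sh @: e)); last first.
    have half e1 e2 : e1 \in E1 -> e2 \in E1 -> sh @: e1 = sh @: e2 ->
        e1 \subset e2.
      move=> h1 h2 e12; apply/subsetP => v v1.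
      have : sh v \in sh @: e2 by rewrite -e12 imset_f.
      case/imsetP => w w2 /shi -> //; first exact: E1hi v1.
      exact: E1hi w2.
    move=> e1 e2 h1 h2 e12; apply/eqP; rewrite eqEsubset.
    by rewrite !half.
  apply/subset_leq_card/subsetP => _ /imsetP[e eE1 ->].
  have eh := E1hi e eE1; move: eE1; rewrite inE => /andP[eE _].
  apply/upshiftP; exists e => //; exists sh.
    by move=> u v ue ve; apply: shi; apply: eh.
  by split=> // v ve; rewrite -/(r _) -/(r _) rsh ?leqnn // eh.
apply: (@leq_trans (#|~: hi| * #|V| ^ k)).
  apply: card_uniform_meet_le => e; rewrite inE => /andP[neE1 eE]; first exact: uE.
  move: neE1; rewrite inE eE /= => /subsetPn[v ve vh].
  by exists v; rewrite ?in_setC.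
(* Ranks outside [hi] lie in the interval of length [M] starting at [#|V| - M]. *)
rewrite leq_mul2r; apply/orP; right.
rewrite cardE -(size_map r) -[M in X in _ <= X](size_iota (#|V| - M)).
apply: uniq_leq_size; first by rewrite map_inj_uniq ?enum_uniq.
move=> _ /mapP[v + ->]; rewrite mem_enum mem_iota !inE -leqNgt.
have : r v < #|V| by apply: ltn_ord.
by move: (r v) => i; lia.
Qed.

(** * Maximizing the weighted homomorphism count *)

Lemma weight_rank_le (V : finType) (k : nat) (E : {set {set V}}) :
    (forall e, e \in E -> #|e| = k) ->
  weight (fun v : V => enum_rank v : nat) E <= #|V| ^ k * (k * #|V|).
Proof.
move=> uE.
apply: leq_trans (leq_mul (card_uniform_le uE) (leqnn _)).
rewrite -sum_nat_const; apply: leq_sum => e eE.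
rewrite -(uE e eE) -sum_nat_const; apply: leq_sum => v _.
exact/ltnW/ltn_ord.
Qed.

(** After division by [Q * #|V| ^ #|W|.+1] the error is [(k + 1) / Q] plus a term [K / #|V|] with
    [K] independent of [V], so [Q] can be fixed before [#|V|] grows. *)
Lemma exists_near_threshold (W V : finType) (k Q : nat) (F : {set {set W}})
    (E0 : {set {set V}}) :
    0 < #|V| -> (forall e, e \in F -> #|e| = k.+1) ->
    (forall e, e \in E0 -> #|e| = k.+1) ->
  exists T : {set {set V}},
    [/\ forall e, e \in T -> #|e| = k.+1, #|T| <= #|E0|,
      forall x y e, enum_rank x <= enum_rank y -> e \in T -> x \in e ->
        y \notin e -> tperm x y @: e \in T &
      Q * #|homs F E0| * #|V| <= Q * #|homs F T| * #|V| +
        (k.+1 * #|V| + Q * (#|F| * k.+1 ^ k.+1 *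
          (Q * (#|F| * #|W| * k.+1 ^ k.+1)).+1)) * #|V| ^ #|W|].
Proof.
(* [C] is the cost of a compression per moved edge; since [M] exceeds [Q * C], a rank gain of [M]
   outweighs that cost in [Psi]. *)
move=> V0 uF uE0; set C := #|F| * #|W| * _; set M := (Q * C).+1.
pose r (v : V) : nat := enum_rank v.
pose n := #|V|.
(* Edges have [k + 1] vertices here, so this is the objective [hom + (1 / Q) n^(h - k - 2) weight]
   multiplied by [Q n^(k + 2)]. *)
pose Psi E := Q * #|homs F E| * n ^ k.+2 + n ^ #|W| * weight r E.
pose ok (E : {set {set V}}) := [forall e in E, #|e| == k.+1] && (#|E| == #|E0|).
have ok0 : ok E0.
  by rewrite /ok eqxx andbT; apply/forall_inP => e /uE0/eqP.
have [E /andP[/forall_inP uE' /eqP cE] Emax'] := arg_maxnP Psi ok0.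
have {}Emax X : ok X -> Psi X <= Psi E := Emax' X.
have {uE'}uE e : e \in E -> #|e| = k.+1 by move/uE'/eqP.
have nb x y : r x + M <= r y -> blocked x y E = set0.
  move=> rxy; apply/eqP; rewrite -cards_eq0 -leqn0 leqNgt; apply/negP => D0.
  have okc : ok (compress x y E).
    rewrite /ok card_compress cE eqxx andbT.
    by apply/forall_inP => e /(compress_uniform uE)/eqP.
  have := Emax _ okc; rewrite /Psi leqNgt => /negP; apply.
  have hc := leq_mul (leqnn Q) (homs_compress x y uF uE).
  have wc := congr1 (muln (n ^ #|W|)) (weight_compress r x y E).
  have gain := leq_mul (leqnn (n ^ #|W| * #|blocked x y E|)) rxy.
  have pos : 0 < n ^ #|W| * #|blocked x y E| by rewrite muln_gt0 expn_gt0 V0.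
  move: hc wc gain pos; rewrite /M -/n -/C.
  move: (n ^ #|W|) (n ^ k.+2) (weight r _) (weight r E) => a b w w'.
  move: #|blocked x y E| #|homs F _| #|homs F E| (r x) (r y) => d h h' p q.
  nia.
exists (upshift r M E); split.
- move=> e /upshiftP[d dE [g ginj [-> _]]].
  by rewrite card_in_imset ?uE.
- by rewrite -cE; apply/subset_leq_card/upshift_sub => //; move=> u v /val_inj/enum_rank_inj.
- by move=> x y e rxy; apply: upshift_up.
(* Maximality of [E] against [E0]; the weight of [E] is at most [(k + 1) n^(k + 2)], and the power
   of [n] cancels. *)
have hE : Q * #|homs F E0| <= Q * #|homs F E| + k.+1 * n ^ #|W|.
  have n0 : 0 < n ^ k.+2 by rewrite expn_gt0 V0.
  rewrite -(leq_pmul2r n0) mulnDl.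
  apply: leq_trans (leq_trans (Emax _ ok0) _); first by rewrite leq_addr.
  rewrite leq_add2l -mulnA mulnCA leq_mul2l; apply/orP; right.
  apply: leq_trans (weight_rank_le uE) _; rewrite -/n.
  by rewrite (expnSr n k.+1) mulnCA.
have sT : upshift r M E \subset E.
  by apply/upshift_sub => //; move=> u v /val_inj/enum_rank_inj.
have cT : #|E :\: upshift r M E| <= M * n ^ k.
  have := card_upshift_loss M uE; rewrite -/r -(cardsID (upshift r M E) E).
  by rewrite (setIidPr sT) leq_add2l.
have hT : #|homs F E| * n <= #|homs F (upshift r M E)| * n
    + #|F| * k.+1 ^ k.+1 * M * n ^ #|W|.
  have n0 : 0 < n ^ k by rewrite expn_gt0 V0.
  rewrite -(leq_pmul2r n0) mulnDl -!mulnA -!expnS.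
  apply: leq_trans (homs_subset_loss (upshift r M E) uF uE) _.
  rewrite leq_add2l -!mulnA !leq_mul2l; apply/orP; right; apply/orP; right.
  by rewrite [n ^ _ * _]mulnC mulnA leq_mul2r cT orbT.
have := leq_mul hE (leqnn n); have := leq_mul (leqnn Q) hT.
rewrite -/n; move: (#|F| * _ * M) => c.
move: #|homs F _| #|homs F E| #|homs F E0| (n ^ #|W|) k.+1 => a b d p k1.
by rewrite !mulnDl !mulnDr; lia.
Qed.

(** * From counts to densities and limits *)

Lemma tperm_imset_swap (V : finType) (x y : V) (e : {set V}) :
  x \in e -> y \notin e -> tperm x y @: e = e :\ x :|: [set y].
Proof.
move=> xe ye; apply/setP => z; rewrite mem_tperm_imset !inE.
case: tpermP => [->|->|/eqP/negPf-> /eqP/negPf->]; last by rewrite orbF.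
  by rewrite eqxx (negPf ye); apply/esym/eqP => xy; rewrite -xy xe in ye.
by rewrite eqxx orbT.
Qed.

(** As [d] and [W] have equal size, the maps with image [d] are the bijections onto [d]. *)
Lemma card_homs_setT (W V : finType) (E : {set {set V}}) :
    (forall e, e \in E -> #|e| = #|W|) ->
  #|homs [set [set: W]] E| = #|E| * #|W|`!.
Proof.
move=> uE; rewrite -sum1_card -sum_nat_const.
pose im (phi : {ffun W -> V}) := phi @: [set: W].
have homsE phi : (phi \in homs [set [set: W]] E) = (im phi \in E).
  rewrite inE; apply/forall_inP/idP => [->//|h e]; first by rewrite inE.
  by rewrite inE => /eqP ->.
rewrite (partition_big im (mem E)) => [|phi]; last by rewrite homsE.
apply: eq_bigr => d dE; rewrite sum1_card -ffactnn -[X in X ^_ _](uE d dE).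
rewrite -card_inj_ffuns_on; apply: eq_card => phi.
rewrite !inE; apply/andP/andP => [[_ /eqP imd]|[/ffun_onP phid /injectiveP inj]].
  split; first by apply/ffun_onP => w; rewrite -imd imset_f.
  apply/injectiveP => u v; apply: (imset_injP _) => //.
  by rewrite -/(im phi) imd uE // cardsT.
have imd : im phi = d.
  apply/eqP; rewrite eqEcard card_imset // cardsT (uE d dE) leqnn andbT.
  by apply/subsetP => _ /imsetP[w _ ->].
by rewrite homsE imd.
Qed.

Require Import Defs.
From mathcomp Require Import all_boot all_order all_algebra.
From mathcomp Require Import all_classical all_reals all_analysis.
From mathcomp Require Import lra.
Import Order.TTheory GRing.Theory Num.Theory.
Local Open Scope classical_set_scope.
Local Open Scope ring_scope.

(** Hence, for a fixed number of vertices, having no more edges means having no larger density. *)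
Lemma edge_densityE (R : realType) (k : nat) (G : hypergraph k) :
  edge_density R G = (#|edges G| * k`!)%:R / (nverts G)%:R ^+ k.
Proof.
rewrite /edge_density /hom_density.
have -> : hom_count (single_edge k) G =
  #|homs [set [set: 'I_k]]%SET (edges G)| by [].
have -> : nverts (single_edge k) = k by rewrite /nverts card_ord.
by rewrite card_homs_setT card_ord //; apply: edges_uniform.
Qed.

Lemma near_threshold (R : realType) (k : nat) (H : hypergraph k) (eps : R) :
    (0 < k)%N -> 0 < eps ->
  exists N, forall G : hypergraph k, (N <= nverts G)%N ->
  exists T : hypergraph k, [/\ is_threshold T, nverts T = nverts G,
    edge_density R T <= edge_density R G &
    hom_density R H G <= hom_density R H T + eps].
Proof.
case: k H => // k H _ eps0.
have archi (x : nat) : exists2 m : nat, (0 < m)%N & x%:R <= eps / 2 * m%:R.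
  exists (Num.truncn (x%:R / (eps / 2))).+1 => //.
  by rewrite mulrC -ler_pdivrMr ?divr_gt0 //; apply/ltW/truncnS_gt.
(* [Q] makes [(k + 1) / Q] at most [eps / 2]; then [N] does the same for [K / n]. *)
have [Q Q0 kQ] := archi k.+1.
pose K := (#|edges H| * k.+1 ^ k.+1 *
  (Q * (#|edges H| * #|vert H| * k.+1 ^ k.+1)).+1)%N.
have [N N0 KN] := archi K.
exists N => G NG; have n0 : (0 < #|vert G|)%N by apply: leq_trans NG.
have [T [uT cT upT homT]] :=
  exists_near_threshold Q n0 (@edges_uniform _ H) (@edges_uniform _ G).
exists (Hypergraph uT); split => //.
- move=> x y; have [xy|/ltnW yx] := leqP (enum_rank x) (enum_rank y).
    by left=> e eT xe ye; rewrite -tperm_imset_swap //; apply: upT.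
  by right=> e eT ye xe; rewrite -tperm_imset_swap //; apply: upT.
- rewrite !edge_densityE ler_pM2r ?ler_nat ?leq_mul2r ?cT ?orbT //.
  by rewrite invr_gt0 exprn_gt0 ?ltr0n.
rewrite /hom_density; set p : R := _ ^+ _.
have p0 : 0 < p by rewrite exprn_gt0 ?ltr0n.
rewrite ler_pdivrMr // mulrDl divfK ?gt_eqF //.
move: homT; rewrite -/K; clearbody K; rewrite -(ler_nat R) !(natrD, natrM) natrX -/(nverts G) -/p.
rewrite -[#|homs _ (edges G)|]/(hom_count H G).
rewrite -[#|homs _ T|]/(hom_count H (Hypergraph uT)).
have {}KN : K%:R <= eps / 2 * (nverts G)%:R.
  by apply: le_trans KN _; rewrite ler_pM2l ?divr_gt0 // ler_nat.
have qn : 0 < (Q%:R * (nverts G)%:R : R) by rewrite mulr_gt0 ?ltr0n.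
move=> le; rewrite -(ler_pM2l qn).
have h1 : k.+1%:R * (nverts G)%:R * p <= eps / 2 * Q%:R * (nverts G)%:R * p.
  by rewrite !ler_wpM2r // ltW.
have h2 : Q%:R * K%:R * p <= Q%:R * (eps / 2 * (nverts G)%:R) * p.
  by rewrite ler_wpM2r ?ler_wpM2l // ltW.
move: le h1 h2; rewrite /= -/(nverts G); lra.
Qed.

(** Since [T] has as many vertices as [G], it stays in the same tail, so late tail suprema over [C]
    exceed those over [D] by at most [eps]. *)
Lemma limsup_class_approx (R : realType) (k : nat) (C D : hypergraph k -> Prop)
    (f : hypergraph k -> R) :
    (forall G, D G -> C G) ->
    (forall eps, 0 < eps -> exists N, forall G, C G -> (N <= nverts G)%N ->
      exists T, [/\ D T, nverts T = nverts G & f G <= f T + eps]) ->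
  limsup_class C f = limsup_class D f.
Proof.
move=> DC approx; rewrite /limsup_class.
set u := (fun n : nat => _); set v := (fun n : nat => _).
have dec (E : hypergraph k -> Prop) : nonincreasing_seq (fun n : nat =>
    ereal_sup [set y : \bar R | exists G : hypergraph k,
      [/\ E G, (n <= nverts G)%N & y = (f G)%:E]]).
  move=> m n mn; apply: ereal_sup_le => _ [G [EG nG ->]].
  by exists G; split=> //; apply: leq_trans nG.
have cu : cvgn u by apply: ereal_nonincreasing_is_cvgn; apply: dec.
have cv : cvgn v by apply: ereal_nonincreasing_is_cvgn; apply: dec.
apply/eqP; rewrite eq_le; apply/andP; split; last first.
  apply: lee_lim => //; apply: nearW => n.
  apply: ereal_sup_le => _ [G [EG nG ->]].
  by exists G; split=> //; apply: DC.
apply/lee_addgt0Pr => eps eps0; have [N hN] := approx eps eps0.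
rewrite -leeBlDr //; apply: lime_ge => //.
exists N => // n Nn; rewrite leeBlDr //.
(* The nonincreasing [u] converges to its infimum, so its limit is at most [u n]. *)
apply: (@le_trans _ _ (u n)).
  rewrite (cvg_lim _ (ereal_nonincreasing_cvgn (dec C))) //.
  by apply: ereal_inf_lbound; exists n.
apply: ge_ereal_sup => _ [G [CG nG ->]].
have [T [DT nT fGT]] := hN G CG (leq_trans Nn nG).
apply: (@le_trans _ _ ((f T)%:E + eps%:E)%E); first by rewrite -EFinD lee_fin.
by rewrite leeD2r //; apply: ereal_sup_ubound; exists T; rewrite nT.
Qed.

Theorem theorem1p6 (R : realType) (k : nat) (hk : (2 <= k)%N)
    (H : hypergraph k) (c : R) (hc0 : 0 <= c) (hc1 : c <= 1) :
  max_density H c = limsup_class (@density_le R k c) (@hom_density R k H) /\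
  limsup_class (@density_le R k c) (@hom_density R k H) =
    limsup_class (class_inter (@density_le R k c) (@is_threshold k))
      (@hom_density R k H).
Proof.
split=> //; apply: limsup_class_approx => [G []//|eps eps0].
have [N hN] := near_threshold H (ltnW hk) eps0.
exists N => G Gc /hN[T [thT nT dT hT]]; exists T; split=> //.
by split=> //; apply: le_trans Gc.
Qed.
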